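(* Let $v\in S^*(A,b)$. If $x\in\check S(A,b)$ and $x\le v$, then $x$ is a minimal optimal solution of the problem of minimizing $Z(x)=x_1\vee x_2\vee\cdots\vee x_n$ over $x\in S(A,b)$.
   Context: Let $I=\{1,\dots,m\}$, $J=\{1,\dots,n\}$, $A=(a_{ij})_{m\times n}$ with $a_{ij}\in[0,1]$, and $b=(b_1,\dots,b_m)$ with $b_i>0$ real. The Łukasiewicz t-norm is $T_L(a,x)=\max\{a+x-1,0\}$ on $[0,1]^2$. The solution set is $S(A,b)=\{x\in[0,1]^n : \sum_{j\in J}T_L(a_{ij},x_j)\ge b_i \text{ for all } i\in I\}$. Vectors are ordered componentwise. A solution $\check x\in S(A,b)$ is minimal if $x\in S(A,b)$ and $x\le\check x$ imply $x=\check x$; $\check S(A,b)$ is the set of all minimal solutions. Here $\vee$ denotes maximum, and $S^*(A,b)$ is the set of all optimal solutions of the problem of minimizing $Z(x)=x_1\vee\cdots\vee x_n$ over $x\in S(A,b)$. A minimal optimal solution is a minimal element of $S^*(A,b)$ for the componentwise order, i.e. an $x\in S^*(A,b)$ such that $y\in S^*(A,b)$ and $y\le x$ imply $y=x$. *)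

(* Defs.v *)
From HB Require Import structures.
From mathcomp Require Import all_boot all_order all_algebra.
From mathcomp Require Import classical_sets reals.

Set Implicit Arguments.
Unset Strict Implicit.
Unset Printing Implicit Defensive.

Import Order.TTheory GRing.Theory Num.Theory.
Local Open Scope ring_scope.
Local Open Scope classical_set_scope.

(* Lukasiewicz t-norm; only meaningful for arguments in [0, 1]. *)
Definition lukasiewicz (R : realType) (a x : R) : R := Num.max (a + x - 1) 0.

Definition vec_le (R : realType) (n : nat) (x y : 'rV[R]_n) : Prop :=
  forall j : 'I_n, x 0 j <= y 0 j.

Definition minimal_elements (R : realType) (n : nat) (S : set 'rV[R]_n) :
    set 'rV[R]_n :=
  [set x | S x /\ forall y, S y -> vec_le y x -> y = x].

Definition solutions (R : realType) (m n : nat) (A : 'M[R]_(m, n))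
    (b : 'rV[R]_m) : set 'rV[R]_n :=
  [set x | (forall j : 'I_n, 0 <= x 0 j <= 1) /\
           (forall i : 'I_m, b 0 i <= \sum_(j < n) lukasiewicz (A i j) (x 0 j))].

(* The default value 0 does not affect the maximum when n > 0 and the entries
   of x are nonnegative, as they are on the set of solutions. *)
Definition max_entry (R : realType) (n : nat) (x : 'rV[R]_n) : R :=
  \big[Num.max/0]_(j < n) x 0 j.

Definition optimal_solutions (R : realType) (m n : nat) (A : 'M[R]_(m, n))
    (b : 'rV[R]_m) : set 'rV[R]_n :=
  [set x | solutions A b x /\
           forall y, solutions A b y -> max_entry x <= max_entry y].

(* Main.v *)
Require Import Defs.
From HB Require Import structures.
From mathcomp Require Import all_boot all_order all_algebra.
From mathcomp Require Import classical_sets reals.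

Set Implicit Arguments.
Unset Strict Implicit.
Unset Printing Implicit Defensive.

Import Order.TTheory GRing.Theory Num.Theory.
Local Open Scope ring_scope.
Local Open Scope classical_set_scope.

(** The objective is monotone, so a solution lying below an optimal one is itself optimal.
    Minimality among all solutions then passes to the subset of optimal ones, since [x] belongs to
    it. *)

Lemma le_max_entry (R : realType) (n : nat) (x y : 'rV[R]_n) :
  vec_le x y -> max_entry x <= max_entry y.
Proof. by move=> xy; apply: le_bigmax2 => j _. Qed.

Theorem theorem5p2 (R : realType) (m n : nat) (A : 'M[R]_(m, n))
    (b : 'rV[R]_m)
    (hA : forall (i : 'I_m) (j : 'I_n), 0 <= A i j <= 1)
    (hb : forall i : 'I_m, 0 < b 0 i)
    (v : 'rV[R]_n) (hv : optimal_solutions A b v)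
    (x : 'rV[R]_n) (hx : minimal_elements (solutions A b) x)
    (hxv : vec_le x v) :
  minimal_elements (optimal_solutions A b) x.
Proof.
have [xS xmin] := hx.
have [_ vopt] := hv.
(* Any optimal [y] below [x] is in particular a solution, so [xmin] applies. *)
split; last by move=> y [yS _]; apply: xmin.
(* Optimality of [x] is the chain $Z(x) \le Z(v) \le Z(y)$. *)
by split=> // y /vopt; apply: le_trans; apply: le_max_entry.
Qed.
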